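(* For every fixed positive integer $N$, there are only finitely many regular $D(N)$-triples of triangular numbers. More precisely, if $\{T_a,T_b,T_c\}$ is a regular $D(N)$-triple with integers $1\le a<b<c$, then $c\ge a+b+1$ and \[ (a+1)(b+1)(a+b+1)\le 4N. \]
   Context: For a positive integer $m$, $T_m=m(m+1)/2$ denotes the $m$-th triangular number. For a positive integer $N$, a $D(N)$-triple is a set of three distinct positive integers such that the product of any two distinct elements, increased by $N$, is a perfect square. A $D(N)$-triple $\{T_a,T_b,T_c\}$ with $1\le a<b<c$ is called regular if $T_c=T_a+T_b+2\sqrt{T_aT_b+N}$, equivalently $(T_c-T_a-T_b)^2=4(T_aT_b+N)$. *)

(* Defs.v *)
From mathcomp Require Import all_boot all_order all_algebra all_field.
From mathcomp Require Import finmap.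
From mathcomp Require Import classical_sets cardinality.

Set Implicit Arguments.
Unset Strict Implicit.
Unset Printing Implicit Defensive.

Import GRing.Theory Num.Theory.

Local Open Scope nat_scope.

Definition triangular (m : nat) : nat := (m * (m + 1)) %/ 2.

Definition perfect_square (n : nat) : Prop := exists k : nat, n = k ^ 2.

Definition D_triple (N : nat) (A : {fset nat}) : Prop :=
  [/\ #|` A| = 3,
      forall x, x \in A -> 0 < x
    & forall x y, x \in A -> y \in A -> x != y -> perfect_square (x * y + N)].

Definition triangular_set (a b c : nat) : {fset nat} :=
  [fset triangular a; triangular b; triangular c]%fset.

(* [sqrtC] of a natural number is its nonnegative square root, so algC serves
   only as a field in which the real square root is available. The notion is
   meant for 1 <= a < b < c. *)
Definition regular_D_triple (N a b c : nat) : Prop :=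
  D_triple N (triangular_set a b c) /\
  ((triangular c)%:R = (triangular a)%:R + (triangular b)%:R
     + 2 * sqrtC (triangular a * triangular b + N)%:R :> algC)%R.

(* Main.v *)
Require Import Defs.
From mathcomp Require Import all_boot all_order all_algebra all_field.
From mathcomp Require Import finmap.
From mathcomp Require Import classical_sets cardinality.
From mathcomp Require Import zify.

Import GRing.Theory Num.Theory.

(** Put [d = T_c - T_a - T_b >= 0], so that [d ^ 2 = 4 T_a T_b + 4 N].
    If [c <= a + b], then [d <= T_(a+b) - T_a - T_b = a b], although
    [4 T_a T_b = a b (a+1) (b+1) > (a b) ^ 2]. Hence [c >= a + b + 1] and
    [d >= T_(a+b+1) - T_a - T_b = (a+1) (b+1)], whence
    [4 N >= (a+1) (b+1) ((a+1) (b+1) - a b) = (a+1) (b+1) (a+b+1)].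
    This bounds [a] and [b], and then the formula for [d] bounds [c]. *)

Local Open Scope nat_scope.
Local Open Scope classical_set_scope.

(** The product is even, so the truncated division is exact; this gives [nia] a polynomial
    equation. *)
Lemma triangular_double (m : nat) : 2 * triangular m = m * (m + 1).
Proof.
rewrite mulnC /triangular divnK // dvdn2 oddM addn1 /=.
by case: (odd m).
Qed.

Lemma triangularD (a b : nat) :
  triangular (a + b) = triangular a + triangular b + a * b.
Proof.
have := triangular_double (a + b).
have := triangular_double a.
have := triangular_double b.
nia.
Qed.

Lemma leq_triangular (m n : nat) : m <= n -> triangular m <= triangular n.
Proof. by move=> /subnKC <-; rewrite triangularD -addnA leq_addr. Qed.

Lemma triangular_ge (m : nat) : m <= triangular m.
Proof. by have := triangular_double m; nia. Qed.

(** Brings regularity from [algC] back to [nat]: the root is nonnegative, so the natural subtraction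
    defining [d] does not truncate, and casts into [algC] are injective. *)
Lemma regular_gap (N a b c : nat) : regular_D_triple N a b c ->
  exists2 d, triangular c = triangular a + triangular b + d
           & d ^ 2 = 4 * (triangular a * triangular b + N).
Proof.
case=> _; set r := sqrtC _ => E.
have r_ge0 : (0 <= r)%R by rewrite sqrtC_ge0 ler0n.
have ab_le_c : triangular a + triangular b <= triangular c.
  by rewrite -(ler_nat algC) E natrD lerDl mulr_ge0 ?ler0n.
exists (triangular c - (triangular a + triangular b)); first by rewrite subnKC.
apply/eqP; rewrite -(eqr_nat algC) natrX natrB // E natrD addrC addKr.
by rewrite exprMn sqrtCK natrM -natrX.
Qed.

Lemma regular_gap_bounds (N a b c d : nat) : 0 < a -> 0 < b ->
  triangular c = triangular a + triangular b + d ->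
  d ^ 2 = 4 * (triangular a * triangular b + N) ->
  a + b + 1 <= c /\ (a + 1) * (b + 1) * (a + b + 1) <= 4 * N.
Proof.
move=> a_gt0 b_gt0 Ec Ed.
have {}Ed : d ^ 2 = (a * b) * ((a + 1) * (b + 1)) + 4 * N.
  have := triangular_double a; have := triangular_double b; nia.
have c_gt : a + b + 1 <= c.
  rewrite leqNgt addn1 ltnS; apply/negP => /leq_triangular.
  rewrite Ec triangularD leq_add2l => d_le.
  have := leq_mul d_le d_le; nia.
split=> //; have := leq_triangular _ _ c_gt.
(* Expanding at [a + (b + 1)] leaves [1 + b + a * (b + 1)], that is [(a + 1) * (b + 1)], as a lower
   bound for [d]. *)
rewrite Ec -addnA triangularD (triangularD b 1) -[triangular 1]/1 => d_ge.
have {}d_ge : (a + 1) * (b + 1) <= d by lia.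
have := leq_mul d_ge d_ge; rewrite (mulnn d) Ed; nia.
Qed.

(** Crude bounds in [N] alone: [a] and [b] are each at most the product bounded by [4 * N], and [c]
    is at most [triangular c]. *)
Lemma regular_index_bounds (N a b c : nat) : 0 < a -> 0 < b ->
  regular_D_triple N a b c ->
  let B := triangular (4 * N) in
  [/\ a <= 4 * N, b <= 4 * N & c <= B + B + 4 * (B * B + N)].
Proof.
move=> a_gt0 b_gt0 /regular_gap[d Ec Ed] B.
have [_ abN] := regular_gap_bounds N a b c d a_gt0 b_gt0 Ec Ed.
have a_le : a <= 4 * N by nia.
have b_le : b <= 4 * N by nia.
split=> //; apply: leq_trans (triangular_ge c) _; rewrite Ec.
have Ba : triangular a <= B := leq_triangular _ _ a_le.
have Bb : triangular b <= B := leq_triangular _ _ b_le.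
have BaBb := leq_mul Ba Bb.
(* This bounds [d] by [4 * (B * B + N)] without extracting a root. *)
have : d <= d ^ 2 by nia.
lia.
Qed.

Theorem theorem3p1 (N : nat) (N_gt0 : 0 < N) :
  finite_set [set A : {fset nat} | exists a b c : nat,
    [/\ 1 <= a, a < b, b < c, A = triangular_set a b c
      & regular_D_triple N a b c]] /\
  (forall a b c : nat, 1 <= a -> a < b -> b < c -> regular_D_triple N a b c ->
    a + b + 1 <= c /\ (a + 1) * (b + 1) * (a + b + 1) <= 4 * N).
Proof.
split; last first.
  move=> a b c a_gt0 ab _ /regular_gap[d Ec Ed].
  exact: (regular_gap_bounds N a b c d a_gt0 (ltn_trans a_gt0 ab) Ec Ed).
pose B := triangular (4 * N).
pose C := B + B + 4 * (B * B + N).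
(* [I_n] holds the naturals below [n]; the successors make the bounds inclusive. The triples all lie
   in the image of this finite box. *)
pose box := `I_(4 * N).+1 `*` `I_(4 * N).+1 `*` `I_C.+1.
apply: (@sub_finite_set _ _
  ((fun p : nat * nat * nat => triangular_set p.1.1 p.1.2 p.2) @` box)).
  move=> _ [a [b [c [a_gt0 ab _ -> reg]]]].
  have [a_le b_le c_le] :=
    regular_index_bounds N a b c a_gt0 (ltn_trans a_gt0 ab) reg.
  by exists (a, b, c).
apply: finite_image.
by apply: finite_setX; first apply: finite_setX; apply: finite_II.
Qed.
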